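(* Let $\mathcal{E}$ be an ellipse in the Euclidean plane, let $M\in\mathcal{E}$ and let $\theta\in(0,\pi)$ with $\theta\neq\pi/2$. Let $\mathcal{E}'=\mathcal{E}'_{M,\theta}$ be the Frégier ellipse of $(M,\theta)$. Let $T_1,T_2\in\mathcal{E}'$ be the points of contact with $\mathcal{E}'$ of the two tangent lines from $M$ to $\mathcal{E}'$ (so that the line $T_1T_2$ is the polar line of $M$ with respect to $\mathcal{E}'$). Then $\angle T_1MT_2=|\pi-2\theta|$. In particular, for fixed $\theta$ this angle does not depend on the position of $M$ on $\mathcal{E}$.
   Context: For a point $M$ on $\mathcal{E}$ and $\theta\in(0,\pi)$, $\theta\ne\pi/2$, the Frégier ellipse $\mathcal{E}'_{M,\theta}$ is the ellipse tangent to every line $NL$ where $N,L\in\mathcal{E}\setminus\{M\}$ are distinct and the triangle $MNL$ has internal angle $\angle NML=\theta$ at $M$ (such an ellipse exists and is unique). A circle counts as an ellipse. *)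

(* Defs.v *)
From mathcomp Require Import all_boot all_order all_algebra.
From mathcomp Require Import all_classical all_reals all_analysis.

Set Implicit Arguments.
Unset Strict Implicit.
Unset Printing Implicit Defensive.

Import Order.TTheory GRing.Theory Num.Theory.
Local Open Scope classical_set_scope.
Local Open Scope ring_scope.

Section EuclideanPlane.
Variable R : realType.
Implicit Types (A B C M N L P T c u v : 'rV[R]_2) (E l : set 'rV[R]_2).

(* The library norm on row vectors is the sup norm, so the Euclidean
   structure of the plane is given by this inner product instead. *)
Definition dot u v : R := \sum_(i < 2) u ord0 i * v ord0 i.

Definition enorm u : R := Num.sqrt (dot u u).

(* The unsigned angle ABC at the vertex B, in [0, pi]; meaningful only when
   A != B and C != B. *)
Definition angle A B C : R :=
  acos (dot (A - B) (C - B) / (enorm (A - B) * enorm (C - B))).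

(* This is a line only when A != B. *)
Definition line A B : set 'rV[R]_2 := [set P | exists t : R, P = A + t *: (B - A)].

Definition is_line l := exists A B, A != B /\ l = line A B.

(* (u, v) is an orthonormal basis giving the directions of the axes, and a, b
   are the semi-axes; a = b is allowed, so circles are ellipses. *)
Definition is_ellipse E := exists c u v (a b : R),
  [/\ [/\ dot u u = 1, dot v v = 1 & dot u v = 0], 0 < a, 0 < b &
      E = [set P | (dot (P - c) u / a) ^+ 2 + (dot (P - c) v / b) ^+ 2 = 1]].

(* For a line l and an ellipse E: tangency means having exactly one common
   point, and T is that point of contact. *)
Definition tangent_at l E T := l `&` E = [set T].

Definition tangent l E := exists T, tangent_at l E T.

Definition fregier_ellipse E M (theta : R) E' :=
  is_ellipse E' /\
  forall N L, E N -> E L -> N != M -> L != M -> N != L ->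
    angle N M L = theta -> tangent (line N L) E'.

Definition tangency_points E' M T1 T2 := exists l1 l2,
  [/\ is_line l1 /\ is_line l2, l1 <> l2, l1 M /\ l2 M,
      tangent_at l1 E' T1 & tangent_at l2 E' T2].

End EuclideanPlane.

(* Main.v *)
Require Import Defs.
From mathcomp Require Import all_boot all_order all_algebra.
From mathcomp Require Import all_classical all_reals all_analysis.
From mathcomp Require Import ring lra.
Import Order.TTheory GRing.Theory Num.Theory.
Local Open Scope classical_set_scope.
Local Open Scope ring_scope.

(** Put the origin at M, the first axis along the tangent to E at M and the
second along the inner normal, so that E reads
q(x, y) = al x^2 + 2 be x y + ga y^2 = y. The ray from M in the direction
(-t, 1) meets E at (-t, 1) / q(-t, 1), and the chord between the parameters t
and s is the line p1 x + p2 y = 1 with p1 = 2 be - al (t + s) and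
p2 = ga - al t s. When the chord is seen from M under the angle theta, the
poles (p1, p2) run along a branch of a hyperbola; five of its points determine
the dual conic of the Fregier ellipse E'. In particular the lines through M
tangent to E' have the directions d = (+- cos theta, sin theta), and the
contact point is M + r d with r = sin theta / (al + q(d)) > 0. *)

(** * Binary quadratic forms and the parameters of the chords *)

Definition qform {R : realType} (a b g x y : R) : R :=
  a * x ^+ 2 + 2 * b * x * y + g * y ^+ 2.

Lemma qform_gt0 {R : realType} (a b g x y : R) :
  0 < a -> 0 < a * g - b ^+ 2 -> (x != 0) || (y != 0) -> 0 < qform a b g x y.
Proof.
move=> a0 d0 xy0.
have E : a * qform a b g x y = (a * x + b * y) ^+ 2 + (a * g - b ^+ 2) * y ^+ 2.
  by rewrite /qform; ring.
rewrite -(pmulr_rgt0 _ a0) E.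
have [y0|y0] := eqVneq y 0.
  move: xy0; rewrite y0 eqxx orbF => x0.
  rewrite mulr0 addr0 expr0n /= mulr0 addr0 exprn_even_gt0 //=.
  by rewrite mulf_neq0 // gt_eqF.
by apply: ltr_wpDl; [exact: sqr_ge0 | rewrite mulr_gt0 // exprn_even_gt0].
Qed.

(** Newton's divided differences: [e1] and [e2] are the first differences, and their difference
    isolates [f2]. *)
Lemma quadratic_vanish {R : realType} (f0 f1 f2 x y z : R) :
  x != y -> y != z -> z != x ->
  f0 + f1 * x + f2 * x ^+ 2 = 0 -> f0 + f1 * y + f2 * y ^+ 2 = 0 ->
  f0 + f1 * z + f2 * z ^+ 2 = 0 -> [/\ f0 = 0, f1 = 0 & f2 = 0].
Proof.
move=> xy yz zx hx hy hz.
have e1 : f1 + f2 * (x + y) = 0.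
  apply: (@mulfI _ (x - y)); first by rewrite subr_eq0.
  by rewrite mulr0 -[RHS](subrr 0) -{1}hx -hy; ring.
have e2 : f1 + f2 * (y + z) = 0.
  apply: (@mulfI _ (y - z)); first by rewrite subr_eq0.
  by rewrite mulr0 -[RHS](subrr 0) -{1}hy -hz; ring.
have f20 : f2 = 0.
  apply: (@mulfI _ (z - x)); first by rewrite subr_eq0.
  by rewrite mulr0 -[RHS](subrr 0) -{1}e2 -e1; ring.
have f10 : f1 = 0 by move: e1; rewrite f20 mul0r addr0.
by move: hx; rewrite f20 f10 !mul0r !addr0.
Qed.

(* [t = m - S k] and [s = m + S k] satisfy [1 + t s = 2 k C] and
   [(1 + t^2)(1 + s^2) = (2 k)^2] exactly when this relation between [m] and [k]
   holds, so the vectors [(-t, 1)] and [(-s, 1)] then make an angle of cosine [C]. *)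
Definition angle_param {R : realType} (C S m k : R) : Prop :=
  0 < k /\ m ^+ 2 = S ^+ 2 * k ^+ 2 + 2 * k * C - 1.

(** Multiplied by [S ^+ 2], the relation becomes [(S ^+ 2 * k + C) ^+ 2 = 1 + S ^+ 2 * m ^+ 2]. The
    larger root [k] is positive because the right side is at least 1, hence exceeds [C ^+ 2]. *)
Lemma angle_param_exists {R : realType} (C S m : R) :
  C ^+ 2 + S ^+ 2 = 1 -> 0 < S -> exists k, angle_param C S m k.
Proof.
move=> CS S0.
pose w := Num.sqrt (1 + S ^+ 2 * m ^+ 2).
have w2 : w ^+ 2 = 1 + S ^+ 2 * m ^+ 2.
  by rewrite sqr_sqrtr // addr_ge0 // mulr_ge0 // sqr_ge0.
have w0 : 0 <= w by exact: sqrtr_ge0.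
have S2 : 0 < S ^+ 2 by rewrite exprn_gt0.
have S20 : S != 0 by rewrite gt_eqF.
exists ((w - C) / S ^+ 2); split.
  apply: divr_gt0 => //; rewrite subr_gt0.
  rewrite ltNge; apply/negP => wC.
  have : w ^+ 2 <= C ^+ 2 by rewrite lerXn2r // nnegrE (le_trans w0).
  rewrite w2 -CS => le; have : 0 <= S ^+ 2 * m ^+ 2 by rewrite mulr_ge0 // sqr_ge0.
  by move: le; lra.
apply: (@mulfI _ (S ^+ 2)); first by rewrite gt_eqF.
have -> : S ^+ 2 * m ^+ 2 = w ^+ 2 - 1 by rewrite w2; ring.
have -> : S ^+ 2 * (S ^+ 2 * ((w - C) / S ^+ 2) ^+ 2 + 2 * ((w - C) / S ^+ 2) * C - 1)
  = (w - C) ^+ 2 + 2 * (w - C) * C - S ^+ 2 by field.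
have -> : S ^+ 2 = 1 - C ^+ 2 by rewrite -CS; ring.
by ring.
Qed.

Lemma angle_param_opp {R : realType} (C S m k : R) :
  angle_param C S m k -> angle_param C S (- m) k.
Proof. by move=> [k0 mk]; split; rewrite // sqrrN. Qed.

(** The relation makes [m ^+ 2] a function of [k]. This yields the distinct values of [k] needed to
    kill polynomials in [k]. *)
Lemma angle_param_neq {R : realType} (C S m m' k k' : R) :
  C ^+ 2 + S ^+ 2 = 1 -> 0 < S ->
  angle_param C S m k -> angle_param C S m' k' -> m ^+ 2 != m' ^+ 2 -> k != k'.
Proof.
by move=> CS S0 [k0 ->] [k0' ->]; apply: contraNneq => ->.
Qed.

(** * The dual conic determined by five chords *)

(** Once [m ^+ 2] is eliminated, the equation is a quadratic in [k] plus [m] times an affine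
    function of [k]. The symmetry [m -> - m] separates the two. The first vanishes for the three [k]
    belonging to [m = 0, 1, 2], the second for the two belonging to [m = 1, 2], so all coefficients
    are zero, which fixes the conic up to the factor [mu]. *)
Lemma dual_conic_eq {R : realType} (al be ga C S B11 B12 B22 c1 c2 : R) :
  al != 0 -> C != 0 -> 0 < S -> C ^+ 2 + S ^+ 2 = 1 ->
  (forall m k, angle_param C S m k ->
     let p1 := 2 * be - 2 * al * m in let p2 := ga + al - 2 * al * C * k in
     B11 * p1 ^+ 2 + 2 * B12 * p1 * p2 + B22 * p2 ^+ 2 + 2 * (p1 * c1 + p2 * c2)
       = 1) ->
  exists mu : R, [/\ mu != 0, B11 = mu * C ^+ 2, B12 = 0, B22 = - mu * S ^+ 2 &
    c1 = - mu * C ^+ 2 * (2 * be) /\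
    c2 = mu * (2 * al + S ^+ 2 * (ga - al))].
Proof.
move=> al0 C0 S0 CS F.
pose r := 2 * be; pose G := ga + al.
(* The [f] and [h] are the coefficients of the part even in [m], the [h] collecting the terms in
   [B12]; the [g] are those of the odd part. *)
pose f0 := B11 * r ^+ 2 - 4 * al ^+ 2 * B11 + B22 * G ^+ 2 + 2 * c1 * r
  + 2 * c2 * G - 1.
pose f1 := 8 * al ^+ 2 * C * B11 - 4 * al * C * G * B22 - 4 * al * C * c2.
pose f2 := 4 * al ^+ 2 * (S ^+ 2 * B11 + C ^+ 2 * B22).
pose g0 := - 4 * al * (r * B11 + G * B12 + c1).
pose g1 := 8 * al ^+ 2 * C * B12.
pose h0 := 2 * B12 * r * G.
pose h1 := - 4 * al * C * B12 * r.
have split m k : angle_param C S m k ->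
    (f0 + h0) + (f1 + h1) * k + f2 * k ^+ 2 + m * (g0 + g1 * k) = 0.
  move=> mk; have := F m k mk; rewrite /= => Fmk.
  case: mk => _ mk.
  rewrite -[RHS](subrr 1) -{1}Fmk /f0 /f1 /f2 /g0 /g1 /h0 /h1 /G /r.
  (* Only this square contains [m ^+ 2], so the relation is applied here and nowhere else. *)
  suff -> : B11 * (2 * be - 2 * al * m) ^+ 2 =
    B11 * ((2 * be) ^+ 2 - 8 * be * al * m
           + 4 * al ^+ 2 * (S ^+ 2 * k ^+ 2 + 2 * k * C - 1)) by ring.
  by rewrite -mk; ring.
have even m k : angle_param C S m k ->
    (f0 + h0) + (f1 + h1) * k + f2 * k ^+ 2 = 0.
  move=> mk; have e1 := split _ _ mk; have e2 := split _ _ (angle_param_opp _ _ _ _ mk).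
  by lra.
have odd m k : m != 0 -> angle_param C S m k -> g0 + g1 * k = 0.
  move=> m0 mk; have e1 := split _ _ mk; have := even _ _ mk => e2.
  by apply: (mulfI m0); rewrite mulr0; lra.
have [k0 K0] := angle_param_exists C S 0 CS S0.
have [k1 K1] := angle_param_exists C S 1 CS S0.
have [k2 K2] := angle_param_exists C S 2 CS S0.
have k01 : k0 != k1 by apply: angle_param_neq K0 K1 _; rewrite //; lra.
have k12 : k1 != k2 by apply: angle_param_neq K1 K2 _; rewrite //; lra.
have k20 : k2 != k0 by apply: angle_param_neq K2 K0 _; rewrite //; lra.
have [f00 f10 f20] := quadratic_vanish _ _ _ _ _ _ k01 k12 k20
  (even _ _ K0) (even _ _ K1) (even _ _ K2).
have o1 := odd _ _ (oner_neq0 _) K1.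
have o2 : g0 + g1 * k2 = 0 by apply: odd K2; rewrite pnatr_eq0.
have g10 : g1 = 0.
  have : k1 - k2 != 0 by rewrite subr_eq0.
  move=> kk; apply: (mulIf kk); rewrite mul0r -[RHS](subrr 0) -{1}o1 -o2; ring.
have g00 : g0 = 0 by move: o1; rewrite g10 mul0r addr0.
have n4 : (4 : R) != 0 by rewrite pnatr_eq0.
have n8 : (8 : R) != 0 by rewrite pnatr_eq0.
have B120 : B12 = 0.
  by move/eqP: g10; rewrite /g1 !mulf_eq0 (negbTE n8) (negbTE al0) (negbTE C0) /= => /eqP.
have c1E : c1 = - B11 * r.
  move/eqP: g00; rewrite /g0 B120 !mulf_eq0 oppr_eq0 (negbTE n4) (negbTE al0) /= => /eqP; lra.
have f2E : B22 = - (B11 / C ^+ 2) * S ^+ 2.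
  move/eqP: f20; rewrite /f2 !mulf_eq0 (negbTE n4) (negbTE al0) /= => /eqP e.
  apply: (@mulfI _ (C ^+ 2)); first by rewrite expf_neq0.
  have -> : C ^+ 2 * (- (B11 / C ^+ 2) * S ^+ 2) = - (S ^+ 2 * B11) by field.
  lra.
pose mu := B11 / C ^+ 2.
have B11E : B11 = mu * C ^+ 2 by rewrite /mu; field.
have c2E : c2 = mu * (2 * al + S ^+ 2 * (ga - al)).
  have e : 2 * al * B11 - G * B22 - c2 = 0.
    apply: (@mulfI _ (4 * al * C)); first by rewrite !mulf_neq0.
    by rewrite mulr0 -f10 /f1 /h1 B120; ring.
  have -> : c2 = 2 * al * B11 - G * B22 by lra.
  rewrite B11E f2E -/mu /G.
  have -> : C ^+ 2 = 1 - S ^+ 2 by rewrite -CS; ring.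
  by ring.
exists mu; split => //; last by rewrite c1E B11E /r; split => //; ring.
(* With [mu = 0] every coefficient of the conic vanishes and [f0 = 0] reads [-1 = 0]. *)
apply/negP => /eqP mu0; move: f00.
rewrite /f0 /h0 B120 c1E f2E -/mu c2E B11E mu0; lra.
Qed.

(** * Inner product and orthonormal frames *)

Lemma dotC {R : realType} (u v : 'rV[R]_2) : dot u v = dot v u.
Proof. by apply: eq_bigr => i _; rewrite mulrC. Qed.

Lemma dotDl {R : realType} (u v w : 'rV[R]_2) : dot (u + v) w = dot u w + dot v w.
Proof. by rewrite -big_split; apply: eq_bigr => i _; rewrite mxE mulrDl. Qed.

Lemma dotZl {R : realType} (k : R) (u w : 'rV[R]_2) : dot (k *: u) w = k * dot u w.
Proof. by rewrite mulr_sumr; apply: eq_bigr => i _; rewrite mxE mulrA. Qed.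

Lemma dotDr {R : realType} (u v w : 'rV[R]_2) : dot w (u + v) = dot w u + dot w v.
Proof. by rewrite dotC dotDl !(dotC w). Qed.

Lemma dotZr {R : realType} (k : R) (u w : 'rV[R]_2) : dot w (k *: u) = k * dot w u.
Proof. by rewrite dotC dotZl dotC. Qed.

Definition orthonormal_frame {R : realType} (u v : 'rV[R]_2) : Prop :=
  [/\ dot u u = 1, dot v v = 1 & dot u v = 0].

(** A 2 by 2 matrix with orthonormal rows has orthonormal columns: with determinant
    [D = p * s - q * r] one has [(r, s) = D (- q, p)] and [D ^+ 2 = 1]. The column relations are
    [e1], [e2] and [e3]. *)
Lemma orthonormal_decomp {R : realType} (u v w : 'rV[R]_2) :
  orthonormal_frame u v -> w = dot w u *: u + dot w v *: v.
Proof.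
case; rewrite /dot !big_ord_recl !big_ord0 !addr0.
set p := u _ _; set q := u _ _; set r := v _ _; set s := v _ _.
set x := w _ _; set y := w _ _ => uu vv uv.
have rE : r = - q * (p * s - q * r).
  by rewrite -[LHS]mulr1 -uu -[LHS]subr0 -[X in _ - X](mulr0 p) -uv; ring.
have sE : s = p * (p * s - q * r).
  by rewrite -[LHS]mulr1 -uu -[LHS]subr0 -[X in _ - X](mulr0 q) -uv; ring.
have DD : (p * s - q * r) ^+ 2 = 1.
  have -> : (p * s - q * r) ^+ 2
    = (p * p + q * q) * (r * r + s * s) - (p * r + q * s) ^+ 2 by ring.
  by rewrite uu vv uv; ring.
have e1 : p * p + r * r = 1.
  rewrite {1 2}rE -[RHS]uu.
  have -> : p * p + - q * (p * s - q * r) * (- q * (p * s - q * r))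
    = p * p + q * q * (p * s - q * r) ^+ 2 by ring.
  by rewrite DD mulr1.
have e2 : q * q + s * s = 1.
  rewrite {1 2}sE -[RHS]uu.
  have -> : q * q + p * (p * s - q * r) * (p * (p * s - q * r))
    = p * p * (p * s - q * r) ^+ 2 + q * q by ring.
  by rewrite DD mulr1.
have e3 : p * q + r * s = 0.
  rewrite {1}rE {2}sE.
  have -> : p * q + - q * (p * s - q * r) * (p * (p * s - q * r))
    = p * q * (1 - (p * s - q * r) ^+ 2) by ring.
  by rewrite DD subrr mulr0.
have p1 : x = (x * p + y * q) * p + (x * r + y * s) * r.
  have -> : (x * p + y * q) * p + (x * r + y * s) * r
    = x * (p * p + r * r) + y * (p * q + r * s) by ring.
  by rewrite e1 e3; ring.
have p2 : y = (x * p + y * q) * q + (x * r + y * s) * s.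
  have -> : (x * p + y * q) * q + (x * r + y * s) * s
    = y * (q * q + s * s) + x * (p * q + r * s) by ring.
  by rewrite e2 e3; ring.
by apply/rowP => i; rewrite !mxE; case: (unliftP ord0 i) => [j|] ->; rewrite ?(ord1 j).
Qed.

Definition frame_pt {R : realType} (M u v : 'rV[R]_2) (x y : R) : 'rV[R]_2 :=
  M + (x *: u + y *: v).

Lemma frame_pt_inj {R : realType} (M u v : 'rV[R]_2) (x y x' y' : R) :
  orthonormal_frame u v -> frame_pt M u v x y = frame_pt M u v x' y' -> x = x' /\ y = y'.
Proof.
move=> [uu vv uv] /addrI e; split.
  have := congr1 (fun w => dot w u) e.
  by rewrite !dotDl !dotZl (dotC v) uu uv !mulr1 !mulr0 !addr0.
have := congr1 (fun w => dot w v) e.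
by rewrite !dotDl !dotZl vv uv !mulr1 !mulr0 !add0r.
Qed.

(** * Equations of an ellipse in a frame *)

(** The form has matrix [P^T diag(1 / a^2, 1 / b^2) P] with [P] orthogonal of rows [(i1, i2)] and
    [(j1, j2)], so its determinant is [1 / (a b)^2]. The centre is that of [E], in coordinates from
    [M]. *)
Lemma ellipse_frame {R : realType} (E : set 'rV[R]_2) (M e1 e2 : 'rV[R]_2) :
  is_ellipse E -> orthonormal_frame e1 e2 ->
  exists a b g c1 c2 : R, [/\ 0 < a, 0 < a * g - b ^+ 2 &
    forall x y, E (frame_pt M e1 e2 x y) <-> qform a b g (x - c1) (y - c2) = 1].
Proof.
move=> [c [u [v [a [b [[uu vv uv] a0 b0 ->]]]]]] on.
have := orthonormal_decomp _ _ u on; set i1 := dot u e1; set i2 := dot u e2 => uE.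
have := orthonormal_decomp _ _ v on; set j1 := dot v e1; set j2 := dot v e2 => vE.
have := orthonormal_decomp _ _ (c - M) on.
set c1 := dot _ e1; set c2 := dot _ e2 => cE.
case: (on) => ee ff ef.
have iE : i1 ^+ 2 + i2 ^+ 2 = 1.
  by rewrite -uu {2}uE dotDr !dotZr.
have jE : j1 ^+ 2 + j2 ^+ 2 = 1.
  by rewrite -vv {2}vE dotDr !dotZr.
have ijE : i1 * j1 + i2 * j2 = 0.
  by rewrite -uv vE dotDr !dotZr -/i1 -/i2; ring.
have D : (i1 * j2 - i2 * j1) ^+ 2 = 1.
  have -> : (i1 * j2 - i2 * j1) ^+ 2
    = (i1 ^+ 2 + i2 ^+ 2) * (j1 ^+ 2 + j2 ^+ 2) - (i1 * j1 + i2 * j2) ^+ 2 by ring.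
  by rewrite iE jE ijE; ring.
have a0' : a != 0 by rewrite gt_eqF.
have b0' : b != 0 by rewrite gt_eqF.
exists (i1 ^+ 2 / a ^+ 2 + j1 ^+ 2 / b ^+ 2), (i1 * i2 / a ^+ 2 + j1 * j2 / b ^+ 2),
  (i2 ^+ 2 / a ^+ 2 + j2 ^+ 2 / b ^+ 2), c1, c2.
split.
- rewrite lt0r addr_ge0 ?divr_ge0 ?sqr_ge0 // andbT.
  apply/negP; rewrite paddr_eq0 ?divr_ge0 ?sqr_ge0 //.
  rewrite !mulf_eq0 !invr_eq0 !expf_eq0 /= (negbTE a0') (negbTE b0') !orbF.
  rewrite ?orbb => /andP[/eqP i10 /eqP j10]; move: D; rewrite i10 j10 !mul0r !mulr0 subr0 expr0n /=.
  by move/eqP; rewrite eq_sym oner_eq0.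
- rewrite [ltRHS](_ : _ = (i1 * j2 - i2 * j1) ^+ 2 / (a ^+ 2 * b ^+ 2)).
    by rewrite D divr_gt0 // mulr_gt0 // exprn_gt0.
  by field; apply/andP.
- move=> x y /=.
  have -> : frame_pt M e1 e2 x y - c = (x - c1) *: e1 + (y - c2) *: e2.
    have -> : frame_pt M e1 e2 x y - c = (x *: e1 + y *: e2) - (c - M).
      by rewrite /frame_pt (addrC M) -addrA opprB.
    by rewrite cE !scalerBl opprD addrACA.
  rewrite !dotDl !dotZl ![dot e1 _]dotC ![dot e2 _]dotC -/i1 -/i2 -/j1 -/j2 /qform.
  set lhs := (X in X = 1 <-> _); set rhs := (X in _ <-> X = 1).
  suff -> : lhs = rhs by [].
  by rewrite /lhs /rhs; field; apply/andP.
Qed.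

(** Since [M] lies on [E], the equation of [E] from [M] is [q(X) = 2 G . X], where [G = (G1, G2)] is
    the matrix of [q] applied to the centre. Taking [e2 = G / w] with [w] the length of [G] turns
    the right side into [2 w y], and dividing by [2 w] gives the stated form. *)
Lemma ellipse_at_point {R : realType} (E : set 'rV[R]_2) (M : 'rV[R]_2) :
  is_ellipse E -> E M ->
  exists (e1 e2 : 'rV[R]_2) (al be ga : R), [/\ orthonormal_frame e1 e2, 0 < al, 0 < al * ga - be ^+ 2 &
    forall x y, E (frame_pt M e1 e2 x y) <-> qform al be ga x y = y].
Proof.
move=> hE EM.
have [c0 [u [v [a0 [b0 [on _ _ _]]]]]] := hE.
have [a [b [g [c1 [c2 [a_gt0 d_gt0 H]]]]]] := ellipse_frame _ M u v hE on.
pose G1 := a * c1 + b * c2; pose G2 := b * c1 + g * c2.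
have cE : qform a b g c1 c2 = 1.
  have := H 0 0; rewrite /frame_pt !scale0r !addr0 => -[/(_ EM) h _].
  by rewrite -[RHS]h /qform; ring.
(* [G] is nonzero because its product with the centre is [q(c1, c2) = 1]. *)
have w_gt0 : 0 < G1 ^+ 2 + G2 ^+ 2.
  rewrite lt0r addr_ge0 ?sqr_ge0 // andbT; apply/negP.
  rewrite paddr_eq0 ?sqr_ge0 // !sqrf_eq0 => /andP[/eqP G10 /eqP G20].
  move: cE; have -> : qform a b g c1 c2 = c1 * G1 + c2 * G2.
    by rewrite /qform /G1 /G2; ring.
  by rewrite G10 G20 !mulr0 addr0 => /eqP; rewrite eq_sym oner_eq0.
pose w := Num.sqrt (G1 ^+ 2 + G2 ^+ 2).
have w0 : 0 < w by rewrite sqrtr_gt0.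
have w2 : w ^+ 2 = G1 ^+ 2 + G2 ^+ 2 by rewrite sqr_sqrtr // ltW.
have wn0 : w != 0 by rewrite gt_eqF.
pose n1 := G1 / w; pose n2 := G2 / w.
have nn : n1 ^+ 2 + n2 ^+ 2 = 1.
  apply: (@mulIf _ (w ^+ 2)); first by rewrite expf_neq0.
  by rewrite mul1r {2}w2 /n1 /n2; field.
have w'0 : 0 < (2 * w)^-1 by rewrite invr_gt0 mulr_gt0.
(* The coefficients are those of [q] in the rotated basis, divided by [2 w]. *)
exists (n2 *: u - n1 *: v), (n1 *: u + n2 *: v), ((2 * w)^-1 * qform a b g n2 (- n1)),
  ((2 * w)^-1 * (a * n1 * n2 + b * (n2 ^+ 2 - n1 ^+ 2) - g * n1 * n2)),
  ((2 * w)^-1 * qform a b g n1 n2).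
split.
- case: on => uu vv uv; rewrite -scaleNr.
  split; rewrite !dotDl !dotDr !dotZl !dotZr (dotC v u) uu vv uv.
  + by rewrite -[RHS]nn; ring.
  + by rewrite -[RHS]nn; ring.
  + by ring.
- apply: mulr_gt0 => //; apply: qform_gt0 => //; rewrite oppr_eq0 -negb_and.
  apply/negP => /andP[/eqP n20 /eqP n10]; move: nn; rewrite n10 n20 expr0n addr0.
  by move=> /eqP; rewrite eq_sym oner_eq0.
- rewrite [ltRHS](_ : _ = (2 * w)^-1 ^+ 2 * ((a * g - b ^+ 2) * (n1 ^+ 2 + n2 ^+ 2) ^+ 2)).
    by rewrite nn expr1n mulr1 mulr_gt0 // exprn_gt0.
  by rewrite /qform; ring.
- move=> x y.
  have -> : frame_pt M (n2 *: u - n1 *: v) (n1 *: u + n2 *: v) x y =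
      frame_pt M u v (x * n2 + y * n1) (y * n2 - x * n1).
    rewrite /frame_pt scalerBr scalerDr !scalerA addrACA -scalerDl.
    by rewrite scalerBl [- _ + _]addrC.
  have G1E : G1 = w * n1 by rewrite /n1 mulrC divfK.
  have G2E : G2 = w * n2 by rewrite /n2 mulrC divfK.
  rewrite (H _ _).
  have -> : qform a b g (x * n2 + y * n1 - c1) (y * n2 - x * n1 - c2)
      = qform a b g (x * n2 + y * n1) (y * n2 - x * n1)
        - 2 * ((x * n2 + y * n1) * G1 + (y * n2 - x * n1) * G2) + qform a b g c1 c2.
    by rewrite /qform /G1 /G2; ring.
  rewrite cE G1E G2E.
  have -> : (x * n2 + y * n1) * (w * n1) + (y * n2 - x * n1) * (w * n2)
    = y * w * (n1 ^+ 2 + n2 ^+ 2) by ring.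
  rewrite nn mulr1.
  set q := qform a b g _ _.
  have -> : qform ((2 * w)^-1 * qform a b g n2 (- n1))
    ((2 * w)^-1 * (a * n1 * n2 + b * (n2 ^+ 2 - n1 ^+ 2) - g * n1 * n2))
    ((2 * w)^-1 * qform a b g n1 n2) x y = (2 * w)^-1 * q.
    by rewrite /q /qform; ring.
  have w20 : 2 * w != 0 by rewrite mulf_neq0.
  split => [e|e].
    have -> : q = 2 * w * y by lra.
    by rewrite mulKf.
  have : 2 * w * ((2 * w)^-1 * q) = 2 * w * y by rewrite e.
  by rewrite mulVKf //; lra.
Qed.

(** * Tangent lines, contact points and the dual equation *)

(** On the line, [E] is the quadratic equation [onE] in the parameter [s]. Uniqueness of the common
    point makes its root double, which gives the contact point; the second conclusion is the
    vanishing of the discriminant, rewritten by Lagrange's identity. *)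
Lemma tangent_line_frame {R : realType} (E : set 'rV[R]_2) (M e1 e2 T : 'rV[R]_2)
    (a b g c1 c2 x y d1 d2 : R) :
  orthonormal_frame e1 e2 -> 0 < a -> 0 < a * g - b ^+ 2 ->
  (forall x y, E (frame_pt M e1 e2 x y) <-> qform a b g (x - c1) (y - c2) = 1) ->
  (d1 != 0) || (d2 != 0) ->
  tangent_at (line (frame_pt M e1 e2 x y) (frame_pt M e1 e2 (x + d1) (y + d2))) E T ->
  let t := - (a * d1 * (x - c1) + b * (d1 * (y - c2) + d2 * (x - c1)) + g * d2 * (y - c2))
           / qform a b g d1 d2 in
  T = frame_pt M e1 e2 (x + t * d1) (y + t * d2) /\
  qform a b g d1 d2 = (a * g - b ^+ 2) * (d1 * (y - c2) - d2 * (x - c1)) ^+ 2.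
Proof.
move=> on a0 dl0 H d0 tg.
set B := a * _ * _ + _ + _; set q := qform _ _ _ _ _ => t.
have q0 : 0 < q by exact: qform_gt0.
have qn0 : q != 0 by rewrite gt_eqF.
have lineE s : frame_pt M e1 e2 x y
    + s *: (frame_pt M e1 e2 (x + d1) (y + d2) - frame_pt M e1 e2 x y)
    = frame_pt M e1 e2 (x + s * d1) (y + s * d2).
  have -> : frame_pt M e1 e2 (x + d1) (y + d2) - frame_pt M e1 e2 x y
      = d1 *: e1 + d2 *: e2.
    rewrite /frame_pt opprD addrACA subrr add0r !scalerDl opprD addrACA.
    by rewrite (addrC (x *: e1)) addrK (addrC (y *: e2)) addrK.
  by rewrite /frame_pt -addrA scalerDr !scalerA addrACA -!scalerDl.
have onE s : E (frame_pt M e1 e2 (x + s * d1) (y + s * d2)) <->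
    q * s ^+ 2 + 2 * B * s + qform a b g (x - c1) (y - c2) = 1.
  rewrite H; set l := (X in X = 1 <-> _); set r := (X in _ <-> X = 1).
  by suff -> : l = r by []; rewrite /l /r /q /B /qform; ring.
have [[t0 T0] ] : (line (frame_pt M e1 e2 x y)
    (frame_pt M e1 e2 (x + d1) (y + d2)) `&` E) T by rewrite tg.
rewrite T0 lineE onE => e0.
have tB : t = - B / q by [].
have t1 : t0 = t.
  (* The other root by Vieta's formula; it also gives a common point, hence equals [t0]. *)
  pose t1 := - (2 * B) / q - t0.
  have : (line (frame_pt M e1 e2 x y)
    (frame_pt M e1 e2 (x + d1) (y + d2)) `&` E) (frame_pt M e1 e2 (x + t1 * d1) (y + t1 * d2)).
    split; first by exists t1; rewrite lineE.
    by rewrite onE -[RHS]e0 /t1; field.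
  rewrite tg => XT; have := eq_trans XT T0; rewrite lineE => /(frame_pt_inj _ _ _ _ _ _ _ on) [].
  move=> /addrI f1 /addrI f2.
  have t10 : t1 = t0.
    by case/orP: d0 => dn0; [exact: (mulIf dn0 f1)|exact: (mulIf dn0 f2)].
  have : t0 + t0 = - (2 * B) / q by rewrite -{1}t10 /t1 subrK.
  move=> e; rewrite tB; have -> : - B / q = (- (2 * B) / q) / 2 by field.
  by rewrite -e; field.
split; first by rewrite t1.
rewrite -[LHS]mulr1 -[in LHS]e0 t1 tB.
have -> : q * (q * (- B / q) ^+ 2 + 2 * B * (- B / q) + qform a b g (x - c1) (y - c2))
  = q * qform a b g (x - c1) (y - c2) - B ^+ 2 by field.
by rewrite /q /B /qform; ring.
Qed.

Lemma angle_rays {R : realType} (M D1 D2 : 'rV[R]_2) (r1 r2 : R) :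
  0 < r1 -> 0 < r2 ->
  angle (M + r1 *: D1) M (M + r2 *: D2)
  = acos (dot D1 D2 / Num.sqrt (dot D1 D1 * dot D2 D2)).
Proof.
move=> r10 r20; rewrite /angle !(addrC M) !addrK /enorm !dotZl !dotZr.
have dd0 (u : 'rV[R]_2) : 0 <= dot u u by apply: sumr_ge0 => i _; rewrite -expr2 sqr_ge0.
rewrite -sqrtrM; last by rewrite !mulr_ge0 // ltW.
have -> : r1 * (r1 * dot D1 D1) * (r2 * (r2 * dot D2 D2))
  = (r1 * r2) ^+ 2 * (dot D1 D1 * dot D2 D2) by ring.
rewrite sqrtrM ?sqr_ge0 // sqrtr_sqr ger0_norm; last by rewrite ltW // mulr_gt0.
by rewrite mulrA -mulf_div divff ?mul1r // gt_eqF // mulr_gt0.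
Qed.

(* The hypotheses on [p] say that the line through [N] and [L] is
   [{P | p . P = 1}]; the conclusion is the dual equation of the ellipse at [p]. *)
Lemma tangent_dual {R : realType} (E : set 'rV[R]_2) (M e1 e2 : 'rV[R]_2)
    (a b g c1 c2 N1 N2 L1 L2 p1 p2 : R) :
  orthonormal_frame e1 e2 -> 0 < a -> 0 < a * g - b ^+ 2 ->
  (forall x y, E (frame_pt M e1 e2 x y) <-> qform a b g (x - c1) (y - c2) = 1) ->
  N1 * L2 - N2 * L1 != 0 ->
  p1 * N1 + p2 * N2 = 1 -> p1 * L1 + p2 * L2 = 1 ->
  tangent (line (frame_pt M e1 e2 N1 N2) (frame_pt M e1 e2 L1 L2)) E ->
  qform a b g (- p2) p1 = (a * g - b ^+ 2) * (1 - (p1 * c1 + p2 * c2)) ^+ 2.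
Proof.
set k := N1 * L2 - N2 * L1 => on a0 dl0 H k0 pN pL [T].
(* The chord is orthogonal to [p]: its direction is [k (- p2, p1)], found by inserting
   [p . N = p . L = 1]. *)
have d1E : L1 - N1 = - (k * p2).
  have -> : L1 - N1 = L1 * 1 - N1 * 1 by ring.
  by rewrite -{1}pN -pL /k; ring.
have d2E : L2 - N2 = k * p1.
  have -> : L2 - N2 = L2 * 1 - N2 * 1 by ring.
  by rewrite -{1}pN -pL /k; ring.
have -> : L1 = N1 + - (k * p2) by rewrite -d1E addrC subrK.
have -> : L2 = N2 + k * p1 by rewrite -d2E addrC subrK.
move=> /(tangent_line_frame _ _ _ _ _ _ _ _ _ _ _ _ _ _ on a0 dl0 H) -[].
  rewrite oppr_eq0 !mulf_eq0 (negbTE k0) /= -negb_and; apply/negP => /andP[/eqP p20 /eqP p10].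
  by move: pN; rewrite p20 p10 !mul0r addr0 => /eqP; rewrite eq_sym oner_eq0.
move=> _ e; apply: (@mulfI _ (k ^+ 2)); first by rewrite expf_neq0.
have -> : k ^+ 2 * qform a b g (- p2) p1 = qform a b g (- (k * p2)) (k * p1).
  by rewrite /qform; ring.
by rewrite e -pN; ring.
Qed.

(** * The Fregier ellipse and its tangents from M *)

(** Each pair [(m, k)] provides an actual chord of [E] seen from [M] under [theta], with ray
    parameters [t = m - S k] and [s = m + S k]. Its line is [p1 x + p2 y = 1], so its tangency to
    [E'] gives the dual equation at [(p1, p2)]. *)
Lemma fregier_dual {R : realType} (E E' : set 'rV[R]_2) (M e1 e2 : 'rV[R]_2)
    (theta al be ga a b g c1 c2 m k : R) :
  0 < theta -> theta < pi ->
  orthonormal_frame e1 e2 -> 0 < al -> 0 < al * ga - be ^+ 2 ->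
  (forall x y, E (frame_pt M e1 e2 x y) <-> qform al be ga x y = y) ->
  0 < a -> 0 < a * g - b ^+ 2 ->
  (forall x y, E' (frame_pt M e1 e2 x y) <-> qform a b g (x - c1) (y - c2) = 1) ->
  fregier_ellipse E M theta E' ->
  angle_param (cos theta) (sin theta) m k ->
  let p1 := 2 * be - 2 * al * m in
  let p2 := ga + al - 2 * al * cos theta * k in
  qform a b g (- p2) p1 = (a * g - b ^+ 2) * (1 - (p1 * c1 + p2 * c2)) ^+ 2.
Proof.
move=> th0 thpi on al0 alga H a0 dl0 H' [_ tg] [k0 mk].
have CS := cos2Dsin2 theta.
have S0 : 0 < sin theta by apply: sin_gt0_pi; rewrite th0.
pose t := m - sin theta * k; pose s := m + sin theta * k.
have ts : t * s = 2 * k * cos theta - 1.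
  have -> : t * s = m ^+ 2 - sin theta ^+ 2 * k ^+ 2 by rewrite /t /s; ring.
  by rewrite mk; ring.
pose qt z := qform al be ga (- z) 1.
have qt0 z : 0 < qt z by apply: qform_gt0; rewrite // oner_eq0 orbT.
have qtn0 z : qt z != 0 by rewrite gt_eqF.
(* The second intersection of [E] with the line through [M] of direction [(- z, 1)]. *)
pose pt z := frame_pt M e1 e2 (- z / qt z) (1 / qt z).
have ptE z : pt z = M + (qt z)^-1 *: (- z *: e1 + 1 *: e2).
  by rewrite /pt /frame_pt scalerDr !scalerA mulr1 mul1r mulrC.
have Ept z : E (pt z).
  apply/H; have -> : qform al be ga (- z / qt z) (1 / qt z) = qt z / qt z ^+ 2.
    by rewrite {3}/qt /qform; field.
  by field.
have M_E : M = frame_pt M e1 e2 0 0 by rewrite /frame_pt !scale0r !addr0.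
have ptM z : pt z != M.
  rewrite M_E; apply/eqP => /(frame_pt_inj _ _ _ _ _ _ _ on)[_ /eqP].
  by rewrite mul1r invr_eq0 (negbTE (qtn0 z)).
have kd : - t / qt t * (1 / qt s) - 1 / qt t * (- s / qt s)
    = 2 * sin theta * k / (qt t * qt s).
  by rewrite /t /s; field; rewrite !qtn0.
have kd0 : - t / qt t * (1 / qt s) - 1 / qt t * (- s / qt s) != 0.
  by rewrite kd gt_eqF // divr_gt0 // !mulr_gt0.
have ptn : pt t != pt s.
  apply/eqP => /(frame_pt_inj _ _ _ _ _ _ _ on)[e e']; move: kd0.
  by rewrite e e' mulrC subrr eqxx.
have dotE z z' : dot (- z *: e1 + 1 *: e2) (- z' *: e1 + 1 *: e2) = 1 + z * z'.
  case: on => ee ff ef.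
  by rewrite !dotDl !dotDr !dotZl !dotZr (dotC e2) ee ff ef; ring.
have ang : angle (pt t) M (pt s) = theta.
  rewrite !ptE angle_rays ?invr_gt0 // !dotE.
  have -> : (1 + t * t) * (1 + s * s) = (2 * k) ^+ 2.
    have -> : (1 + t * t) * (1 + s * s) = (1 + t * s) ^+ 2 + (s - t) ^+ 2 by ring.
    rewrite ts; have -> : s - t = 2 * sin theta * k by rewrite /s /t; ring.
    transitivity ((2 * k) ^+ 2 * (cos theta ^+ 2 + sin theta ^+ 2)); first by ring.
    by rewrite CS mulr1.
  have kk0 : 0 < 2 * k by rewrite mulr_gt0.
  rewrite sqrtr_sqr gtr0_norm // ts.
  have -> : (1 + (2 * k * cos theta - 1)) / (2 * k) = cos theta.
    by field; rewrite gt_eqF.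
  by rewrite cosK // in_itv /= !ltW.
move=> p1 p2.
have p1E : p1 = 2 * be - al * (t + s) by rewrite /p1 /t /s; ring.
have p2E : p2 = ga - al * (t * s) by rewrite ts /p2; ring.
apply: (tangent_dual E' M e1 e2 a b g c1 c2 _ _ _ _ p1 p2 on a0 dl0 H' kd0).
(* The point [pt t] lies on the line because [p2 - p1 * t] equals [qt t]: the terms in [t * s]
   cancel. *)
- have -> : p1 * (- t / qt t) + p2 * (1 / qt t) = (p2 - p1 * t) / qt t by field.
  have -> : p2 - p1 * t = qt t by rewrite p1E p2E /qt /qform; ring.
  by rewrite divff.
- have -> : p1 * (- s / qt s) + p2 * (1 / qt s) = (p2 - p1 * s) / qt s by field.
  have -> : p2 - p1 * s = qt s by rewrite p1E p2E /qt /qform; ring.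
  by rewrite divff.
- exact: (tg (pt t) (pt s) (Ept t) (Ept s) (ptM t) (ptM s) ptn ang).
Qed.

Lemma is_line_through {R : realType} (l : set 'rV[R]_2) (M : 'rV[R]_2) :
  is_line l -> l M -> exists2 D : 'rV[R]_2, D != 0 & l = line M (M + D).
Proof.
move=> [A [B [AB ->]]] [t0 ->]; exists (B - A); first by rewrite subr_eq0 eq_sym.
apply/seteqP; split => P [t ->].
  exists (t - t0).
  by rewrite [_ + (B - A)]addrC addrK scalerBl -addrA (addrC (t *: _)) addNKr.
exists (t0 + t).
by rewrite [_ + (B - A)]addrC addrK scalerDl addrA.
Qed.

Lemma line_scale {R : realType} (M D : 'rV[R]_2) (k : R) :
  k != 0 -> line M (M + k *: D) = line M (M + D).
Proof.
move=> k0; apply/seteqP; split => P [t ->].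
  by exists (t * k); rewrite !(addrC M) !addrK scalerA.
by exists (t / k); rewrite !(addrC M) !addrK scalerA divfK.
Qed.

(** For a line through [M] of direction [d], the known dual conic reduces tangency to
    [(C d2)^2 = (S d1)^2], with [C] and [S] the cosine and sine of [theta]. Positivity of [r]
    matters for the angle: it puts the contact points on the rays of direction [(C, S)] and
    [(- C, S)], not on the opposite ones. *)
Lemma fregier_tangency {R : realType} (E E' : set 'rV[R]_2) (M e1 e2 : 'rV[R]_2)
    (theta al be ga : R) :
  0 < theta -> theta < pi -> theta != pi / 2 ->
  orthonormal_frame e1 e2 -> 0 < al -> 0 < al * ga - be ^+ 2 ->
  (forall x y, E (frame_pt M e1 e2 x y) <-> qform al be ga x y = y) ->
  fregier_ellipse E M theta E' ->
  forall l T, is_line l -> l M -> tangent_at l E' T ->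
  exists sg r : R, [/\ sg = 1 \/ sg = -1, 0 < r,
    l = line M (M + ((sg * cos theta) *: e1 + sin theta *: e2)) &
    T = M + r *: ((sg * cos theta) *: e1 + sin theta *: e2)].
Proof.
move=> th0 thpi thn on al0 alga H fr l T ll lM tg.
have [a [b [g [c1 [c2 [a0 dl0 H']]]]]] := ellipse_frame _ M e1 e2 (proj1 fr) on.
have CS := cos2Dsin2 theta.
have S0 : 0 < sin theta by apply: sin_gt0_pi; rewrite th0.
have Sn0 : sin theta != 0 by rewrite gt_eqF.
have C0 : cos theta != 0.
  apply/eqP => c0; move/eqP: thn; apply.
  rewrite -[LHS]cosK ?in_itv /= ?ltW // -[RHS]cosK ?cos_pihalf ?c0 //.
  by rewrite in_itv /=; have := pi_gt0 R; lra.
pose dl := a * g - b ^+ 2.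
have dln0 : dl != 0 by rewrite gt_eqF.
(* With [A] the matrix of [E'], the dual equation is [p^T A^-1 p = (1 - p . c)^2]; expanding the
   square gives the coefficients of [A^-1 - c c^T]. *)
have [|mu [mu0 B11 B12 B22 [c1E c2E]]] := dual_conic_eq al be ga (cos theta) (sin theta)
  (g / dl - c1 ^+ 2) (- b / dl - c1 * c2) (a / dl - c2 ^+ 2) c1 c2
  (lt0r_neq0 al0) C0 S0 CS.
  move=> m k mk p1 p2.
  have := fregier_dual E E' M e1 e2 theta al be ga a b g c1 c2 m k th0 thpi on al0 alga
    H a0 dl0 H' fr mk.
  rewrite /= -/p1 -/p2 -/dl => e.
  transitivity (qform a b g (- p2) p1 / dl - (p1 * c1 + p2 * c2) ^+ 2
    + 2 * (p1 * c1 + p2 * c2)); first by rewrite /qform; field.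
  by rewrite e; field.
have gE : g = dl * (mu * cos theta ^+ 2 + c1 ^+ 2).
  by rewrite -B11; field.
have bE : b = - dl * c1 * c2.
  by rewrite -[LHS]addr0 -[X in _ + X](mulr0 dl) -B12; field.
have aE : a = dl * (- mu * sin theta ^+ 2 + c2 ^+ 2).
  by rewrite -B22; field.
have M_E : M = frame_pt M e1 e2 0 0 by rewrite /frame_pt !scale0r !addr0.
have frE x y : M + (x *: e1 + y *: e2) = frame_pt M e1 e2 (0 + x) (0 + y).
  by rewrite !add0r.
have [D D0 lE] := is_line_through _ _ ll lM.
have DE := orthonormal_decomp _ _ D on.
set d1 := dot D e1 in DE; set d2 := dot D e2 in DE.
have d0 : (d1 != 0) || (d2 != 0).
  rewrite -negb_and; apply/negP => /andP[/eqP d10 /eqP d20].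
  by move/eqP: D0; apply; rewrite DE d10 d20 !scale0r addr0.
have [sg [sg1 sgd]] : exists sg : R, (sg = 1 \/ sg = -1) /\
    cos theta * d2 = sg * sin theta * d1.
  move: tg; rewrite lE DE frE {1}M_E.
  move=> /(tangent_line_frame _ _ _ _ _ _ _ _ _ _ _ _ _ _ on a0 dl0 H' d0) [_].
  rewrite -/dl !sub0r => e.
  (* By [aE], [bE] and [gE], [q(d)] is this quantity plus [dl (d1 c2 - d2 c1)^2], and tangency
     equates [q(d)] with the latter term. *)
  have : dl * mu * ((cos theta * d2) ^+ 2 - (sin theta * d1) ^+ 2) = 0.
    rewrite -[RHS](subrr (qform a b g d1 d2)) {2}e /qform {1}aE {1}bE {1}gE.
    by ring.
  move/eqP; rewrite !mulf_eq0 (negbTE dln0) (negbTE mu0) /= subr_sqr mulf_eq0.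
  case/orP => /eqP h; [exists 1|exists (-1)]; (split; first by [left|right]); lra.
have sg2 : sg ^+ 2 = 1 by case: sg1 => ->; ring.
have Dk : D = (d2 / sin theta) *: ((sg * cos theta) *: e1 + sin theta *: e2).
  rewrite {1}DE scalerDr !scalerA divfK //; congr (_ *: _ + _).
  have -> : d2 / sin theta * (sg * cos theta) = sg * (cos theta * d2) / sin theta by field.
  rewrite sgd; have -> : sg * (sg * sin theta * d1) / sin theta = sg ^+ 2 * d1 by field.
  by rewrite sg2 mul1r.
have k0 : d2 / sin theta != 0.
  apply/eqP => k0; move/eqP: D0; apply; by rewrite Dk k0 scale0r.
have lE' : l = line M (M + ((sg * cos theta) *: e1 + sin theta *: e2)).
  by rewrite lE {1}Dk line_scale.
have q0 : 0 < qform a b g (sg * cos theta) (sin theta).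
  by apply: qform_gt0; rewrite // Sn0 orbT.
move: tg; rewrite lE' frE {1}M_E.
move=> /(tangent_line_frame _ _ _ _ _ _ _ _ _ _ _ _ _ _ on a0 dl0 H') -[].
  by rewrite Sn0 orbT.
set t := _ / _; rewrite !add0r => TE _.
exists sg, t; split => //; last first.
  by rewrite TE /frame_pt scalerDr !scalerA.
rewrite /t divr_gt0 // !sub0r.
have K0 : 0 < al + qform al be ga (sg * cos theta) (sin theta).
  by rewrite addr_gt0 // qform_gt0 // Sn0 orbT.
(* Since [c1] and [c2] are themselves multiples of [mu], the numerator contains [mu ^+ 2], so the
   sign of [mu] need not be known. *)
rewrite [ltRHS](_ : _ = dl * mu ^+ 2 * (cos theta ^+ 2 * sin theta *
    (al + qform al be ga (sg * cos theta) (sin theta)))).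
  have mu2 : 0 < mu ^+ 2 by rewrite exprn_even_gt0.
  have C2 : 0 < cos theta ^+ 2 by rewrite exprn_even_gt0.
  by apply: mulr_gt0; apply: mulr_gt0 => //; apply: mulr_gt0.
transitivity (dl * mu * (sg * cos theta * sin theta) *
   (- sin theta * c1 + sg * cos theta * c2)).
  rewrite aE bE gE.
  transitivity (dl * mu * (sg * cos theta * sin theta) *
   (- sin theta * c1) + dl * mu * cos theta ^+ 2 * sin theta * c2); first by ring.
  have -> : dl * mu * cos theta ^+ 2 * sin theta * c2
    = dl * mu * cos theta ^+ 2 * sin theta * c2 * sg ^+ 2 by rewrite sg2 mulr1.
  by ring.
rewrite c1E c2E /qform.
have sS : sin theta ^+ 2 = 1 - cos theta ^+ 2 by rewrite -CS; ring.
transitivity (dl * mu ^+ 2 * (cos theta ^+ 2 * sin theta *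
  (2 * be * sg * cos theta * sin theta
   + sg ^+ 2 * (2 * al + sin theta ^+ 2 * (ga - al))))); first by ring.
congr (_ * (_ * _)); rewrite exprMn sg2 sS; ring.
Qed.

(** * The angle between the contact points *)

(** The contact points lie on rays with unit directions [(C, S)] and [(- C, S)], whose inner product
    is [S^2 - C^2 = cos (pi - 2 theta)]. The absolute value brings the argument into [[0, pi]],
    where [acos] inverts [cos]. *)
Lemma fregier_angle {R : realType} (E E' : set 'rV[R]_2) (M T1 T2 : 'rV[R]_2) (theta : R) :
  is_ellipse E -> 0 < theta -> theta < pi -> theta != pi / 2 ->
  E M -> fregier_ellipse E M theta E' -> tangency_points E' M T1 T2 ->
  angle T1 M T2 = `|pi - 2 * theta|.
Proof.
move=> hE th0 thpi thn EM fr [l1 [l2 [[ll1 ll2] l12 [l1M l2M] tg1 tg2]]].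
have [e1 [e2 [al [be [ga [on al0 alga H]]]]]] := ellipse_at_point _ _ hE EM.
have key := fregier_tangency _ _ _ _ _ _ _ _ _ th0 thpi thn on al0 alga H fr.
have [s1 [r1 [s1E r10 l1E ->]]] := key _ _ ll1 l1M tg1.
have [s2 [r2 [s2E r20 l2E ->]]] := key _ _ ll2 l2M tg2.
(* Equal signs would make the two tangent lines coincide. *)
have s12 : s1 * s2 = -1.
  have : s1 != s2 by apply/eqP => s12; apply: l12; rewrite l1E l2E s12.
  by case: s1E s2E => -> [] ->; rewrite ?eqxx // => _; ring.
have sq (s : R) : s = 1 \/ s = -1 -> s * s = 1 by case=> ->; ring.
have dotE (s s' : R) : dot ((s * cos theta) *: e1 + sin theta *: e2)
   ((s' * cos theta) *: e1 + sin theta *: e2) = s * s' * cos theta ^+ 2 + sin theta ^+ 2.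
  case: on => ee ff ef.
  by rewrite !dotDl !dotDr !dotZl !dotZr (dotC e2) ee ff ef; ring.
rewrite angle_rays // !dotE s12 (sq _ s1E) (sq _ s2E) mul1r cos2Dsin2 mulr1 sqrtr1 divr1.
have -> : -1 * cos theta ^+ 2 + sin theta ^+ 2 = cos `|pi - 2 * theta|.
  have -> : cos `|pi - 2 * theta| = cos (pi - 2 * theta).
    by case: ger0P => // _; rewrite cosN.
  rewrite cosB cospi sinpi mulrC; have -> : 2 * theta = theta + theta by ring.
  by rewrite cosD; ring.
rewrite cosK // in_itv /= normr_ge0 ler_norml; apply/andP; split; lra.
Qed.

Theorem proposition2 (R : realType) (E : set 'rV[R]_2) (theta : R)
    (hE : is_ellipse E) (theta_gt0 : 0 < theta) (theta_ltpi : theta < pi)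
    (theta_neq : theta != pi / 2) :
  (forall (M : 'rV[R]_2) (E' : set 'rV[R]_2) (T1 T2 : 'rV[R]_2),
     E M -> fregier_ellipse E M theta E' -> tangency_points E' M T1 T2 ->
     angle T1 M T2 = `|pi - 2 * theta|) /\
  (forall (M N : 'rV[R]_2) (E'M E'N : set 'rV[R]_2) (S1 S2 T1 T2 : 'rV[R]_2),
     E M -> fregier_ellipse E M theta E'M -> tangency_points E'M M S1 S2 ->
     E N -> fregier_ellipse E N theta E'N -> tangency_points E'N N T1 T2 ->
     angle S1 M S2 = angle T1 N T2).
Proof.
have key M E' T1 T2 := fregier_angle E E' M T1 T2 theta hE theta_gt0 theta_ltpi theta_neq.
split=> [M E' T1 T2 EM fr tp|M N E'M E'N S1 S2 T1 T2 EM frM tpM EN frN tpN].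
  exact: key EM fr tp.
by rewrite (key _ _ _ _ EM frM tpM) (key _ _ _ _ EN frN tpN).
Qed.
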